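(* Let $F_2$ be the free group of rank $2$ and let $p\in(1,\infty)$. Then the canonical homomorphism $H_1(F_2;\mathbb{C})\longrightarrow H_1^p(F_2)$ is the zero map.
   Context: $\mathbb{N}=\{0,1,2,\dots\}$, and $0^0=1$. For a group $G$, let $C_*(G;\mathbb{C})$ be the bar complex: $C_k(G;\mathbb{C})$ is the $\mathbb{C}$-vector space with basis the symbols $[e,g_1,\dots,g_k]$, $(g_1,\dots,g_k)\in G^k$. For $x_0,\dots,x_k\in G$ put $[x_0,x_1,\dots,x_k] := [e,x_0^{-1}x_1,\dots,x_0^{-1}x_k]$. The boundary operator is $\partial [x_0,\dots,x_k] = \sum_{j=0}^k (-1)^j [x_0,\dots,\widehat{x_j},\dots,x_k]$. The homology of $C_*(G;\mathbb{C})$ is the group homology $H_*(G;\mathbb{C})$. Let $G$ be finitely generated, $S$ a finite generating set, $d_S$ the (left-invariant) word metric, and for $g=(g_1,\dots,g_k)\in G^k$ let $\operatorname{diam}_S(g) := \operatorname{diam}_S\{e,g_1,\dots,g_k\}$ be the diameter with respect to $d_S$. For $n\in\mathbb{N}$, $p\in[1,\infty)$ and $c=\sum_{g\in G^k} a_g\,[e,g_1,\dots,g_k]$ let $$\|c\|_{n,p}^S := \Bigl(\sum_{g\in G^k}|a_g|^p\cdot \operatorname{diam}_S(g)^n\Bigr)^{1/p}.$$ $C_k^p(G)$ denotes the Fréchet space obtained by completing $C_k(G;\mathbb{C})$ with respect to the family $(\|\cdot\|_{n,p}^S+\|\partial\,\cdot\|_{n,p}^S)_{n\in\mathbb{N}}$.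 The boundary operator extends continuously, $C_*^p(G)$ is a chain complex, independent of $S$, and $H_*^p(G)$ denotes its homology. The canonical homomorphism $H_*(G;\mathbb{C})\to H_*^p(G)$ is induced by the canonical chain map $C_*(G;\mathbb{C})\to C_*^p(G)$ into the completion. *)

(* Defs.v *)
From HB Require Import structures.
From mathcomp Require Import all_boot all_order all_algebra.
From mathcomp Require Import generic_quotient finmap complex ring lra zify.
From mathcomp.multinomials Require Import freeg.
From mathcomp Require Import all_classical all_reals all_analysis.
Set Implicit Arguments.
Unset Strict Implicit.
Unset Printing Implicit Defensive.
Import Order.TTheory GRing.Theory Num.Theory.
Import numFieldNormedType.Exports ComplexField.Normc.
Local Open Scope classical_set_scope.
Local Open Scope quotient_scope.
Local Open Scope ring_scope.

(* For subspaces Z, B of V, [subquot Z B] is Z modulo the relation x - y \in B;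
   both homology (cycles modulo boundaries) and the completion (Cauchy sequences
   modulo null sequences) are instances. *)
Section Subquotient.
Context (K : fieldType) (V : lmodType K) (Z B : submodClosed V).

Record submod := SubMod { submod_val : V; submod_mem : submod_val \in Z }.

HB.instance Definition _ := [isSub for submod_val].
HB.instance Definition _ := [Choice of submod by <:].
HB.instance Definition _ := [SubChoice_isSubLmodule of submod by <:].

Lemma submodN (v : V) : (- v \in B) = (v \in B).
Proof.
by apply/idP/idP => /(rpredZ (- 1)); rewrite scaleN1r ?opprK; apply.
Qed.

Definition subquot_rel : rel submod := fun x y => val x - val y \in B.

Lemma subquot_rel_equiv : equiv_class_of subquot_rel.
Proof.
split => [x|x y|y x z]; rewrite /subquot_rel.
- by rewrite subrr rpred0.
- by rewrite -submodN opprB.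
- by move=> xy yz; rewrite -(subrK (val y) (val x)) -addrA rpredD.
Qed.

Canonical subquot_equiv := EquivRelPack subquot_rel_equiv.

Definition subquot := {eq_quot subquot_equiv}.

HB.instance Definition _ := Choice.on subquot.
HB.instance Definition _ := EqQuotient.on subquot.

Definition class (x : submod) : subquot := \pi_subquot x.

Lemma class_eq x y : (class x == class y) = (val x - val y \in B).
Proof. by rewrite /class eqmodE. Qed.

Lemma classP (X : subquot) : exists x, X = class x.
Proof. by exists (repr X); rewrite /class reprK. Qed.

Definition subquot_add (X Y : subquot) := class (repr X + repr Y).
Definition subquot_opp (X : subquot) := class (- repr X).
Definition subquot_scale (a : K) (X : subquot) := class (a *: repr X).

Lemma repr_class x : val (repr (class x)) - val x \in B.
Proof. by rewrite -class_eq /class reprK. Qed.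

Lemma class_add x y : subquot_add (class x) (class y) = class (x + y).
Proof.
apply/eqP; rewrite class_eq.
set x' := repr _; set y' := repr _.
have -> : val (x' + y') - val (x + y) = (val x' - val x) + (val y' - val y).
  by rewrite [val (x + y)]raddfD [val (x' + y')]raddfD /= opprD addrACA.
by rewrite rpredD // repr_class.
Qed.

Lemma class_opp x : subquot_opp (class x) = class (- x).
Proof.
apply/eqP; rewrite class_eq [val (- repr _)]raddfN [val (- x)]raddfN /=.
by rewrite -opprD submodN repr_class.
Qed.

Lemma class_scale a x : subquot_scale a (class x) = class (a *: x).
Proof.
apply/eqP; rewrite class_eq [val (a *: repr _)]linearZ [val (a *: x)]linearZ /=.
by rewrite -scalerBr rpredZ ?repr_class.
Qed.

Let addA : associative subquot_add.
Proof.
move=> X Y W; have [x ->] := classP X; have [y ->] := classP Y.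
by have [w ->] := classP W; rewrite !class_add addrA.
Qed.

Let addC : commutative subquot_add.
Proof. by move=> X Y; rewrite /subquot_add addrC. Qed.

Let add0 : left_id (class 0) subquot_add.
Proof. by move=> X; have [x ->] := classP X; rewrite class_add add0r. Qed.

Let addN : left_inverse (class 0) subquot_opp subquot_add.
Proof.
by move=> X; have [x ->] := classP X; rewrite class_opp class_add addNr.
Qed.

HB.instance Definition _ := GRing.isZmodule.Build subquot addA addC add0 addN.

Let scaleA a b X :
  subquot_scale a (subquot_scale b X) = subquot_scale (a * b) X.
Proof. by have [x ->] := classP X; rewrite !class_scale scalerA. Qed.

Let scale1 : left_id 1 subquot_scale.
Proof. by move=> X; have [x ->] := classP X; rewrite class_scale scale1r. Qed.

Let scaleDr : right_distributive subquot_scale +%R.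
Proof.
move=> a X Y; have [x ->] := classP X; have [y ->] := classP Y.
by rewrite /GRing.add /= class_add !class_scale class_add scalerDr.
Qed.

Let scaleDl X : {morph subquot_scale^~ X : a b / a + b}.
Proof.
move=> a b; have [x ->] := classP X.
by rewrite [RHS]/GRing.add /= !class_scale class_add scalerDl.
Qed.

HB.instance Definition _ := GRing.Zmodule_isLmodule.Build K subquot
  scaleA scale1 scaleDr scaleDl.

Lemma class_is_linear : linear class.
Proof. by move=> a x y; rewrite -class_add -class_scale. Qed.

HB.instance Definition _ :=
  GRing.isLinear.Build K submod subquot *:%R class class_is_linear.

Lemma class_eq0 x : (class x == 0) = (val x \in B).
Proof. by rewrite -[0]/(class 0) class_eq subr0. Qed.

End Subquotient.

Section SubquotientMap.
Context (K : fieldType) (V W : lmodType K).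
Context (Z B : submodClosed V) (Z' B' : submodClosed W) (f : {linear V -> W}).
Context (fZ : forall v, v \in Z -> f v \in Z').
Context (fB : forall v, v \in B -> f v \in B').

Definition submod_map (x : submod Z) : submod Z' :=
  SubMod (fZ (submod_mem x)).

Let map_fun (X : subquot Z B) : subquot Z' B' :=
  class B' (submod_map (repr X)).

Let map_fun_class x : map_fun (class B x) = class B' (submod_map x).
Proof.
by apply/eqP; rewrite class_eq /= -linearB fB //; apply: repr_class.
Qed.

Let map_fun_linear : linear map_fun.
Proof.
move=> a X Y; have [x ->] := classP X; have [y ->] := classP Y.
rewrite -linearP !map_fun_class -linearP; congr (class B' _).
by apply: val_inj; rewrite linearP /= linearP.
Qed.

Definition subquot_map : {linear subquot Z B -> subquot Z' B'} :=
  HB.pack map_fun (GRing.isLinear.Build K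
    (subquot Z B) (subquot Z' B') *:%R map_fun map_fun_linear).

Lemma subquot_map_class x :
  subquot_map (class B x) = class B' (submod_map x).
Proof. exact: map_fun_class. Qed.

End SubquotientMap.

Section Homology.
Context (K : fieldType).

Record chain_complex := ChainComplex {
  chain :> nat -> lmodType K;
  bdry k : {linear chain k.+1 -> chain k};
  bdryK k x : bdry k (bdry k.+1 x) = 0 }.

Section HomologyGroup.
Context (C : chain_complex) (k : nat).

(* The complex is extended by zero in negative degrees. *)
Definition cycle : {pred C k} :=
  match k return {pred C k} with
  | 0 => fun=> true
  | j.+1 => fun x => bdry C j x == 0
  end.

Definition boundary : {pred C k} := fun x => `[< exists y, x = bdry C k y >].

Lemma cycle_submod : submod_closed cycle.
Proof.
rewrite /cycle; case: k => [|j] //; split => [|a x y].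
  by rewrite unfold_in linear0.
by rewrite !unfold_in linearP => /eqP -> /eqP ->; rewrite scaler0 addr0.
Qed.

Lemma boundary_submod : submod_closed boundary.
Proof.
split => [|a x y]; first by apply/asboolP; exists 0; rewrite linear0.
move=> /asboolP[u ->] /asboolP[v ->].
by apply/asboolP; exists (a *: u + v); rewrite linearP.
Qed.

HB.instance Definition _ := GRing.isSubmodClosed.Build K (C k) cycle cycle_submod.
HB.instance Definition _ :=
  GRing.isSubmodClosed.Build K (C k) boundary boundary_submod.

Definition homology : lmodType K := subquot cycle boundary.

End HomologyGroup.

Record chain_map (C D : chain_complex) := ChainMap {
  cmap :> forall k, {linear C k -> D k};
  cmap_bdry : forall k x, cmap k (bdry C k x) = bdry D k (cmap k.+1 x) }.

Section InducedMap.
Context (C D : chain_complex) (f : chain_map C D) (k : nat).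

Lemma cmap_cycle x : x \in @cycle C k -> f k x \in @cycle D k.
Proof.
rewrite !unfold_in /cycle; case: k x => [//|j] x /eqP x0.
by rewrite -cmap_bdry x0 linear0.
Qed.

Lemma cmap_boundary x : x \in @boundary C k -> f k x \in @boundary D k.
Proof.
by move=> /asboolP[y ->]; apply/asboolP; exists (f k.+1 y); rewrite cmap_bdry.
Qed.

Definition homology_map : {linear homology C k -> homology D k} :=
  subquot_map cmap_cycle cmap_boundary.

End InducedMap.
End Homology.

Section FreeGroup.
Context (T : choiceType).

(* (x, true) is the generator x and (x, false) its inverse; a group element is
   a reduced word. *)
Definition letter := (T * bool)%type.
Definition letter_inv (a : letter) : letter := (a.1, ~~ a.2).

Lemma letter_invK : involutive letter_inv.
Proof. by case=> x b; rewrite /letter_inv negbK. Qed.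

Definition is_reduced : pred (seq letter) := sorted (fun a b => b != letter_inv a).

Record free_group := FreeGroup { word_of :> seq letter; word_is_reduced : is_reduced word_of }.

HB.instance Definition _ := [isSub for word_of].
HB.instance Definition _ := [Choice of free_group by <:].

Definition push (a : letter) (w : seq letter) : seq letter :=
  if w is b :: w' then if b == letter_inv a then w' else a :: w else [:: a].

Lemma reduced_push a w : is_reduced w -> is_reduced (push a w).
Proof.
case: w => [//|b w] /= bw; case: ifP => [_|ab]; last by rewrite /= ab.
exact: path_sorted bw.
Qed.

Lemma pushK a w : is_reduced w -> push (letter_inv a) (push a w) = w.
Proof.
case: w => [_|b w bw] /=; first by rewrite letter_invK eqxx.
case: eqP => [bE|_] /=; last by rewrite letter_invK eqxx.
rewrite -bE; case: w bw => [//|c w] /= /andP[cb _].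
by rewrite (negPf cb).
Qed.

Definition reduce_cat (u v : seq letter) : seq letter := foldr push v u.

Lemma reduced_cat u v : is_reduced v -> is_reduced (reduce_cat u v).
Proof. by move=> rv; elim: u => //= a u; apply: reduced_push. Qed.

Lemma reduce_cat_push a u v :
  is_reduced u -> is_reduced v -> reduce_cat (push a u) v = push a (reduce_cat u v).
Proof.
case: u => [//|b u] bu rv /=; case: eqP => [->|//].
by rewrite -{1}[a]letter_invK pushK // reduced_cat.
Qed.

Lemma reduce_catA u v w : is_reduced v -> is_reduced w ->
  reduce_cat u (reduce_cat v w) = reduce_cat (reduce_cat u v) w.
Proof.
move=> rv rw; elim: u => //= a u ->.
by rewrite reduce_cat_push // reduced_cat.
Qed.

Lemma reduce_cat0 u : is_reduced u -> reduce_cat u [::] = u.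
Proof.
elim: u => //= a u IH au; rewrite IH; last exact: path_sorted au.
by case: u au {IH} => [//|b u] /= /andP[/negPf ->].
Qed.

Definition word_inv (u : seq letter) : seq letter := rev (map letter_inv u).

Lemma reduced_inv u : is_reduced u -> is_reduced (word_inv u).
Proof.
rewrite /is_reduced /word_inv rev_sorted sorted_map; apply: sub_sorted.
by move=> a b /= ba; rewrite letter_invK eq_sym.
Qed.

Lemma reduce_catVl u : is_reduced u -> reduce_cat (word_inv u) u = [::].
Proof.
elim: u => //= a u IH au.
rewrite /word_inv /= rev_cons -cats1 /reduce_cat foldr_cat /= letter_invK eqxx.
exact: IH (path_sorted au).
Qed.

Definition free_one := FreeGroup (isT : is_reduced [::]).
Definition free_mul (u v : free_group) :=
  FreeGroup (reduced_cat u (word_is_reduced v)).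
Definition free_inv (u : free_group) := FreeGroup (reduced_inv (word_is_reduced u)).

Let mulA : associative free_mul.
Proof. by move=> u v w; apply: val_inj; apply: reduce_catA; apply: word_is_reduced. Qed.

Let mul1 : left_id free_one free_mul.
Proof. by move=> u; apply: val_inj. Qed.

Let mulr1 : right_id free_one free_mul.
Proof. by move=> u; apply: val_inj; apply/reduce_cat0/word_is_reduced. Qed.

Let mulV : left_inverse free_one free_inv free_mul.
Proof. by move=> u; apply: val_inj; apply/reduce_catVl/word_is_reduced. Qed.

Let mulrV : right_inverse free_one free_inv free_mul.
Proof.
move=> u; rewrite -{1}[u](_ : free_inv (free_inv u) = u) ?mulV //.
by apply: val_inj; rewrite /= /word_inv map_rev revK -map_comp map_id_in // => a _;
  rewrite /= letter_invK.
Qed.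

HB.instance Definition _ := isGroup.Build free_group mulA mul1 mulr1 mulV mulrV.

Definition free_gen (x : T) : free_group := FreeGroup (isT : is_reduced [:: (x, true)]).

Local Open Scope group_scope.

Lemma free_gen_ext (H : groupType) (f : T -> H) :
  exists phi : free_group -> H,
    [/\ {morph phi : u v / u * v}, forall x, phi (free_gen x) = f x &
     forall psi : free_group -> H, {morph psi : u v / u * v} ->
       (forall x, psi (free_gen x) = f x) -> psi =1 phi].
Proof.
pose ev a := if a.2 then f a.1 else (f a.1)^-1.
have evV a : ev (letter_inv a) = (ev a)^-1.
  by case: a => x [] //; rewrite /ev /= invgK.
pose evw (w : seq letter) := \prod_(a <- w) ev a.
have ev_push a w : evw (push a w) = ev a * evw w.
  case: w => [|b w]; first by rewrite /evw big_seq1 big_nil mulg1.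
  rewrite /=; case: eqP => [->|_]; last by rewrite /evw big_cons.
  by rewrite /evw big_cons evV mulVKg.
exists (fun u => evw u); split => [u v|x|psi psiM psi_gen u].
- rewrite /=; case: u => u ru /=; elim: u {ru} => [|a u IH].
    by rewrite /evw big_nil mul1g.
  by rewrite /= ev_push IH /evw big_cons mulgA.
- by rewrite /evw big_seq1.
- have psi1 : psi 1 = 1.
    by apply: (mulgI (psi 1)); rewrite -psiM !mulg1.
  have psiV w : psi w^-1 = (psi w)^-1.
    by apply: (mulgI (psi w)); rewrite -psiM !mulgV.
  case: u => u ru; elim: u ru => [|a u IH] ru.
    by rewrite /evw big_nil -psi1; congr psi; apply: val_inj.
  pose l : free_group := FreeGroup (isT : is_reduced [:: a]).
  have -> : FreeGroup ru = l * FreeGroup (path_sorted ru : is_reduced u).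
    apply: val_inj => /=; rewrite -[LHS]reduce_cat0 //= reduce_cat0 //.
    exact: path_sorted ru.
  rewrite psiM IH /= ev_push; congr (_ * _).
  case: a {ru} @l => x [] l; rewrite /ev /= -psi_gen.
    by congr psi; apply: val_inj.
  by rewrite -psiV; congr psi; apply: val_inj.
Qed.
End FreeGroup.

Definition F2 : groupType := free_group 'I_2.

Section Minkowski.
Context (R : realType) (p : R) (hp : 1 <= p).
Let p0 : 0 < p := lt_le_trans ltr01 hp.
Let pN0 : p != 0. Proof. by rewrite gt_eqF. Qed.

Lemma powR_sum_le (a b x y : R) : 0 < a -> 0 < b -> 0 <= x -> 0 <= y ->
  ((x + y) / (a + b)) `^ p <=
  a / (a + b) * (x / a) `^ p + b / (a + b) * (y / b) `^ p.
Proof.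
move=> a0 b0 x0 y0; have s0 : 0 < a + b by rewrite addr_gt0.
have tb : b / (a + b) = 1 - a / (a + b) by field; rewrite gt_eqF.
have t0 : 0 <= a / (a + b) by rewrite divr_ge0 // ltW.
have t1 : a / (a + b) <= 1 by rewrite ler_pdivrMr // mul1r lerDl ltW.
have -> : (x + y) / (a + b) = a / (a + b) * (x / a) + b / (a + b) * (y / b).
  by field; rewrite !gt_eqF.
rewrite tb; apply: (convex_powR hp (Itv01 t0 t1)) => //=;
  by rewrite inE /= in_itv /= andbT divr_ge0 // ltW.
Qed.

Section Sum.
Context (I : Type) (r : seq I) (x y w : I -> R).
Context (x0 : forall i, 0 <= x i) (y0 : forall i, 0 <= y i).
Context (w0 : forall i, 0 <= w i).

Let powR_div (u v : R) : 0 <= u -> 0 < v -> (u / v) `^ p = u `^ p / v `^ p.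
Proof.
move=> u0 v0; rewrite powRM ?invr_ge0 ?(ltW v0) //; congr (_ * _).
by rewrite -powR_inv1 ?ltW // -powRrM mulN1r powRN.
Qed.

Let sum_le (a b : R) : 0 < a -> 0 < b ->
  \sum_(i <- r) x i `^ p * w i <= a `^ p ->
  \sum_(i <- r) y i `^ p * w i <= b `^ p ->
  \sum_(i <- r) (x i + y i) `^ p * w i <= (a + b) `^ p.
Proof.
move=> a0 b0 Xa Yb; have s0 : 0 < a + b by rewrite addr_gt0.
rewrite -[leRHS]mul1r -ler_pdivrMr ?powR_gt0 // mulr_suml.
apply: (@le_trans _ _ (\sum_(i <- r)
   (a / (a + b) / a `^ p * (x i `^ p * w i) +
    b / (a + b) / b `^ p * (y i `^ p * w i)))).
  apply: ler_sum => i _.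
  have := powR_sum_le a0 b0 (x0 i) (y0 i).
  rewrite !powR_div ?addr_ge0 // => /(ler_wpM2r (w0 i)).
  move=> h; rewrite mulrAC; apply: (le_trans h).
  rewrite mulrDl le_eqVlt; apply/orP; left; apply/eqP.
  by congr (_ + _); rewrite -!mulrA; congr (_ * (_ * _)); rewrite mulrCA.
rewrite big_split /= -!mulr_sumr.
apply: (@le_trans _ _ (a / (a + b) / a `^ p * a `^ p +
                       b / (a + b) / b `^ p * b `^ p)).
  by apply: lerD; apply: ler_wpM2l => //; rewrite !divr_ge0 ?powR_ge0 // ltW.
by rewrite !divfK ?gt_eqF ?powR_gt0 // -mulrDl divff // gt_eqF.
Qed.

Let root_le (Z e : R) : 0 <= Z -> 0 < e -> Z <= (Z `^ p^-1 + e) `^ p.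
Proof.
move=> Z0 e0; have {1}-> : Z = (Z `^ p^-1) `^ p.
  by rewrite -powRrM mulVf // powRr1.
by apply: ge0_ler_powR; rewrite ?nnegrE ?addr_ge0 ?powR_ge0 ?lerDl ?(ltW e0) ?ltW.
Qed.

Let sum_ge0 (z : I -> R) : 0 <= \sum_(i <- r) z i `^ p * w i.
Proof. by apply: sumr_ge0 => i _; rewrite mulr_ge0 ?powR_ge0. Qed.

Lemma finite_minkowski :
  (\sum_(i <- r) (x i + y i) `^ p * w i) `^ p^-1 <=
  (\sum_(i <- r) x i `^ p * w i) `^ p^-1 +
  (\sum_(i <- r) y i `^ p * w i) `^ p^-1.
Proof.
apply/ler_addgt0Pr => e e0; have e2 : 0 < e / 2 by rewrite divr_gt0.
rewrite [e]splitr addrACA.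
have pos (z : I -> R) : 0 < (\sum_(i <- r) z i `^ p * w i) `^ p^-1 + e / 2.
  by rewrite ltr_wpDl ?powR_ge0.
have h := sum_le (pos x) (pos y) (root_le (sum_ge0 x) e2) (root_le (sum_ge0 y) e2).
have s0 := addr_ge0 (ltW (pos x)) (ltW (pos y)).
rewrite -[leRHS](powRr1 s0) -[X in _ <= _ `^ X](mulfV pN0) powRrM.
by apply: ge0_ler_powR; rewrite ?nnegrE ?invr_ge0 ?powR_ge0 ?sum_ge0 ?(ltW p0).
Qed.
End Sum.
End Minkowski.

Section Completion.
Context (R : realType).

Record seminorms (V : lmodType R[i]) := Seminorms {
  sn :> nat -> V -> R;
  sn_ge0 n x : 0 <= sn n x;
  snD n x y : sn n (x + y) <= sn n x + sn n y;
  snZ n a x : sn n (a *: x) = normc a * sn n x }.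

Lemma sn0 (V : lmodType R[i]) (q : seminorms V) n : q n 0 = 0.
Proof. by rewrite -(scale0r (0 : V)) snZ normc0 mul0r. Qed.

Lemma cvg_sn_lin (V : lmodType R[i]) (q : seminorms V) n (T : Type)
    (F : set_system T) (FF : Filter F) a (u v : T -> V) :
  q n (u t) @[t --> F] --> 0 -> q n (v t) @[t --> F] --> 0 ->
  q n (a *: u t + v t) @[t --> F] --> 0.
Proof.
move=> u0 v0.
have h : normc a * q n (u t) + q n (v t) @[t --> F] --> 0.
  rewrite -[0 in X in _ --> X]addr0 -[0 in X in X + _](mulr0 (normc a)).
  by apply: cvgD => //; apply: cvgM => //; apply: cvg_cst.
apply: squeeze_cvgr h; last exact: (cvg_cst 0).
by apply: nearW => t; rewrite sn_ge0 /= -snZ snD.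
Qed.

Section Space.
Context (V : lmodType R[i]) (q : seminorms V).

(* Completion with respect to a countable family of seminorms, as Cauchy
   sequences modulo null sequences. Only its vector space structure and the
   extension of continuous linear maps to it are needed: homology is the
   algebraic ker/im, without closure of the image. *)
Definition cauchy_seq : {pred nat -> V} := fun u =>
  `[< forall n, q n (u ij.1 - u ij.2) @[ij --> (\oo, \oo)] --> 0 >].

Definition null_seq : {pred nat -> V} := fun u =>
  `[< forall n, q n (u i) @[i --> \oo] --> 0 >].

Lemma cauchy_seq_submod : submod_closed cauchy_seq.
Proof.
split => [|a u v /asboolP cu /asboolP cv]; apply/asboolP => n.
  rewrite [X in X @ _](_ : _ = cst 0); first exact: cvg_cst.
  by apply/funext => ij /=; rewrite subrr sn0.
rewrite [X in X @ _](_ : _ = fun ij =>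
  q n (a *: (u ij.1 - u ij.2) + (v ij.1 - v ij.2))).
  exact: (@cvg_sn_lin _ _ _ _ _ _ a (fun ij => u ij.1 - u ij.2)
    (fun ij => v ij.1 - v ij.2)).
apply/funext => ij; congr (q n _).
by rewrite /= scalerBr opprD addrACA.
Qed.

Lemma null_seq_submod : submod_closed null_seq.
Proof.
split => [|a u v /asboolP cu /asboolP cv]; apply/asboolP => n.
  rewrite [X in X @ _](_ : _ = cst 0); first exact: cvg_cst.
  by apply/funext => i /=; rewrite sn0.
exact: cvg_sn_lin.
Qed.

HB.instance Definition _ :=
  GRing.isSubmodClosed.Build _ (nat -> V) cauchy_seq cauchy_seq_submod.
HB.instance Definition _ :=
  GRing.isSubmodClosed.Build _ (nat -> V) null_seq null_seq_submod.

Definition completion : lmodType R[i] := subquot cauchy_seq null_seq.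

Lemma cst_cauchy x : (fun=> x) \in cauchy_seq.
Proof.
apply/asboolP => n; rewrite [X in X @ _](_ : _ = cst 0); first exact: cvg_cst.
by apply/funext => ij /=; rewrite subrr sn0.
Qed.

Let embed_fun (x : V) : completion := class null_seq (SubMod (cst_cauchy x)).

Let embed_linear : linear embed_fun.
Proof.
move=> a x y; rewrite /embed_fun -[RHS]class_is_linear; congr (class _ _).
exact: val_inj.
Qed.

Definition embed : {linear V -> completion} :=
  HB.pack embed_fun (GRing.isLinear.Build R[i] V completion *:%R embed_fun
    embed_linear).

Lemma embedE x : embed x = class null_seq (SubMod (cst_cauchy x)).
Proof. by []. Qed.

End Space.

Definition continuous_for (V W : lmodType R[i]) (q : seminorms V)
    (r : seminorms W) (f : V -> W) : Prop :=
  forall n, exists (m : nat) (M : R), forall x, r n (f x) <= M * q m x.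

Section Extension.
Context (V W : lmodType R[i]) (q : seminorms V) (r : seminorms W).
Context (f : {linear V -> W}).
Context (fb : continuous_for q r f).

Let seqmap_fun (u : nat -> V) : nat -> W := f \o u.

Let seqmap_linear : linear seqmap_fun.
Proof. by move=> a u v; apply/funext => i; rewrite /seqmap_fun /= linearP. Qed.

Let seqmap : {linear (nat -> V) -> (nat -> W)} :=
  HB.pack seqmap_fun (GRing.isLinear.Build R[i] (nat -> V) (nat -> W) *:%R
    seqmap_fun seqmap_linear).

Let bounded_cvg0 (T : Type) (F : set_system T) (FF : Filter F) (u : T -> V) :
  (forall n, q n (u t) @[t --> F] --> 0) ->
  forall n, r n (f (u t)) @[t --> F] --> 0.
Proof.
move=> u0 n; have [m [M fM]] := fb n.
have h : M * q m (u t) @[t --> F] --> 0.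
  by rewrite -[0 in X in _ --> X](mulr0 M); apply: cvgM => //; apply: cvg_cst.
apply: squeeze_cvgr h; last exact: (cvg_cst 0).
by apply: nearW => t; rewrite sn_ge0 fM.
Qed.

Let seqmap_cauchy u : u \in cauchy_seq q -> seqmap u \in cauchy_seq r.
Proof.
move=> /asboolP cu; apply/asboolP => n.
rewrite [X in X @ _](_ : _ = fun ij => r n (f (u ij.1 - u ij.2))).
  exact: (@bounded_cvg0 _ _ _ (fun ij => u ij.1 - u ij.2)).
by apply/funext => ij; rewrite linearB.
Qed.

Let seqmap_null u : u \in null_seq q -> seqmap u \in null_seq r.
Proof. by move=> /asboolP cu; apply/asboolP => n; apply: bounded_cvg0. Qed.

(* The continuous extension: [f] applied termwise to Cauchy sequences. *)
Definition extension : {linear completion q -> completion r} :=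
  subquot_map seqmap_cauchy seqmap_null.

Lemma extension_class (u : submod (cauchy_seq q)) (fu : submod (cauchy_seq r)) :
  val fu = f \o val u -> extension (class (null_seq q) u) = class (null_seq r) fu.
Proof.
move=> fuE; rewrite /extension subquot_map_class; congr (class _ _).
exact: val_inj.
Qed.

Lemma extension_embed x : extension (embed q x) = embed r (f x).
Proof. exact: extension_class. Qed.

End Extension.

Lemma extension_comp0 (U V W : lmodType R[i]) (q : seminorms U)
    (r : seminorms V) (s : seminorms W) (f : {linear U -> V})
    (g : {linear V -> W}) fb gb (X : completion q) :
  (forall x, g (f x) = 0) -> @extension _ _ r s g gb (@extension _ _ q r f fb X) = 0.
Proof.
move=> gf0; have [u ->] := classP X; rewrite /extension !subquot_map_class.
apply/eqP; rewrite class_eq0 (_ : val _ = 0) ?rpred0 //.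
by apply/funext => i /=; rewrite gf0.
Qed.

End Completion.

Section GroupMetric.
Context (G : groupType).
Local Open Scope group_scope.

Definition spells (S : {fset G}) (n : nat) (g : G) : Prop :=
  exists w : seq G, [/\ size w = n,
    forall s, s \in w -> (s \in S) || (s^-1 \in S) & g = \prod_(s <- w) s].

Definition generates (S : {fset G}) : Prop := forall g, exists n, spells S n g.

(* Junk value 0 outside the subgroup generated by S. *)
Definition word_length (S : {fset G}) (g : G) : nat :=
  if pselect (exists n, `[< spells S n g >]) is left e then ex_minn e else 0%N.

Definition word_dist (S : {fset G}) (x y : G) : nat := word_length S (x^-1 * y).

(* Diameter of {e, g_1, ..., g_k}. *)
Definition diam (S : {fset G}) k (g : k.-tuple G) : nat :=
  \max_(x <- 1%g :: g) \max_(y <- 1%g :: g) word_dist S x y.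
End GroupMetric.

Lemma fglift_linear (A : nzRingType) (K : choiceType) (M : lmodType A)
  (f : K -> M) : linear (fglift f : {freeg K / A} -> M).
Proof.
pose F : {additive {freeg K / A} -> M} :=
  HB.pack (fglift f : {freeg K / A} -> M) (GRing.isAdditive.Build
    {freeg K / A} M (fglift f) (lift_is_additive f)).
have FZ a x : F (a *: x) = a *: F x.
  rewrite [in RHS](_ : x = \sum_(z <- dom x) << coeff z x *g z >>); last first.
    by rewrite freeg_sumE.
  rewrite [a *: x](_ : _ = \sum_(z <- dom x) << a * coeff z x *g z >>) //.
  rewrite [LHS]raddf_sum [in RHS]raddf_sum scaler_sumr; apply: eq_bigr => z _.
  by rewrite /= !liftU scalerA.
by move=> a x y; rewrite -[LHS]/(F _) raddfD FZ.
Qed.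

Section Bar.
Context (R : realType) (G : groupType).

(* The basis element indexed by (g_1, ..., g_k) is [e, g_1, ..., g_k]. *)
Definition bar_chain k : lmodType R[i] := {freeg (k.-tuple G) / R[i]}.

(* [x_0, ..., x_k] = [e, x_0^-1 x_1, ..., x_0^-1 x_k]. *)
Definition symbol k (x : k.+1.-tuple G) : bar_chain k :=
  << [tuple of [seq ((thead x)^-1 * y)%g | y <- behead x]] >>.

Definition face k (j : 'I_k.+2) (x : k.+2.-tuple G) : k.+1.-tuple G :=
  [tuple tnth x (fintype.lift j i) | i < k.+1].

Definition bar_bdry_basis k (g : k.+1.-tuple G) : bar_chain k :=
  \sum_(j < k.+2) (-1) ^+ j *: symbol (face j [tuple of 1%g :: g]).

Definition bar_bdry k : {linear bar_chain k.+1 -> bar_chain k} :=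
  HB.pack (fglift (@bar_bdry_basis k) : bar_chain k.+1 -> bar_chain k)
  (GRing.isLinear.Build R[i] (bar_chain k.+1) (bar_chain k) *:%R
    (fglift (@bar_bdry_basis k)) (fglift_linear (@bar_bdry_basis k))).

Arguments bar_bdry : simpl never.

Lemma symbolM k a (x : k.+1.-tuple G) :
  symbol [tuple (a * tnth x i)%g | i < k.+1] = symbol x.
Proof.
congr << _ >>; apply: eq_from_tnth => i.
rewrite !tnth_map !tnth_behead !tnth_mktuple /thead tnth_mktuple.
by rewrite invgM -!mulgA mulKg.
Qed.

Lemma symbol1 k (g : k.-tuple G) : symbol [tuple of 1%g :: g] = << g >>.
Proof.
congr << _ >>; apply: eq_from_tnth => i;
  rewrite !tnth_map tnth_behead theadE invg1 mul1g -[RHS](tnthS 1%g).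
by congr tnth; apply: val_inj; rewrite /= inordK ?ltnS.
Qed.

Lemma bar_bdry_symbol k (x : k.+2.-tuple G) :
  bar_bdry k (symbol x) = \sum_(j < k.+2) (-1) ^+ j *: symbol (face j x).
Proof.
rewrite /bar_bdry /= /symbol liftU scale1r; apply: eq_bigr => j _; congr (_ *: _).
rewrite -[RHS](symbolM (thead x)^-1%g); congr symbol.
apply: eq_from_tnth => i; rewrite !tnth_mktuple.
case: (unliftP ord0 (fintype.lift j i)) => [l|] ->; last first.
  by rewrite tnth0 mulVg.
rewrite tnthS tnth_map tnth_behead; congr (_ * tnth x _)%g.
apply: val_inj; rewrite /= inordK // ltnS; exact: (ltn_ord l).
Qed.

Let swap k (ij : 'I_k.+3 * 'I_k.+2) : 'I_k.+3 * 'I_k.+2 :=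
  if (ij.2 < ij.1)%N then (inord ij.2, inord ij.1.-1)
  else (inord ij.2.+1, inord ij.1).

Let swapE1 k (i : 'I_k.+3) (j : 'I_k.+2) : (j < i)%N ->
  (swap (i, j)).1 = j :> nat /\ (swap (i, j)).2 = i.-1 :> nat.
Proof.
rewrite /swap /= => ji; rewrite ji /=; have := ltn_ord i; have := ltn_ord j.
by move=> *; rewrite !inordK //; lia.
Qed.

Let swapE2 k (i : 'I_k.+3) (j : 'I_k.+2) : (i <= j)%N ->
  (swap (i, j)).1 = j.+1 :> nat /\ (swap (i, j)).2 = i :> nat.
Proof.
rewrite /swap /= => ij; rewrite ltnNge ij /=.
have := ltn_ord i; have := ltn_ord j.
by move=> *; rewrite !inordK //; lia.
Qed.

Let swapK k : involutive (@swap k).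
Proof.
move=> [i j]; have [ij|ji] := leqP i j.
  have [e1 e2] := swapE2 ij; case: (swap (i, j)) e1 e2 => i' j' /= e1 e2.
  have ji' : (j' < i')%N by rewrite e1 e2 ltnS.
  have [e1' e2'] := swapE1 ji'.
  by rewrite [swap _]surjective_pairing; congr pair; apply: val_inj;
    rewrite /= ?e1' ?e2' ?e1 ?e2.
have [e1 e2] := swapE1 ji; case: (swap (i, j)) e1 e2 => i' j' /= e1 e2.
have ij' : (i' <= j')%N by rewrite e1 e2; lia.
have [e1' e2'] := swapE2 ij'.
by rewrite [swap _]surjective_pairing; congr pair; apply: val_inj;
  rewrite /= ?e1' ?e2' ?e1 ?e2 //; lia.
Qed.

Let face_swap k (x : k.+3.-tuple G) ij :
  face (swap ij).2 (face (swap ij).1 x) = face ij.2 (face ij.1 x).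
Proof.
case: ij => i j; apply: eq_from_tnth => l; rewrite !tnth_mktuple.
congr tnth; apply: val_inj; rewrite /= /bump.
have [ij|ji] := leqP i j.
  by have [-> ->] := swapE2 ij; lia.
by have [-> ->] := swapE1 ji; lia.
Qed.

Let sign_swap k (ij : 'I_k.+3 * 'I_k.+2) :
  (-1) ^+ ((swap ij).1 + (swap ij).2)%N = - (-1) ^+ (ij.1 + ij.2)%N :> R[i].
Proof.
case: ij => i j; have [ij|ji] := leqP i j.
  by have [-> ->] := swapE2 ij; rewrite /= addSn exprS mulN1r addnC.
have [-> ->] := swapE1 ji; case: (nat_of_ord i) ji => //= n _.
by rewrite addSn exprS mulN1r opprK addnC.
Qed.

Lemma bar_bdryK k (c : bar_chain k.+2) : bar_bdry k (bar_bdry k.+1 c) = 0.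
Proof.
have basis (g : k.+2.-tuple G) : bar_bdry k (bar_bdry k.+1 << g >>) = 0.
  rewrite -symbol1 bar_bdry_symbol; set x := [tuple of _].
  pose F (ij : 'I_k.+3 * 'I_k.+2) := (-1) ^+ (ij.1 + ij.2)%N *: symbol (face ij.2 (face ij.1 x)).
  have -> : bar_bdry k (\sum_(j < k.+3) (-1) ^+ j *: symbol (face j x)) =
      \sum_(ij : 'I_k.+3 * 'I_k.+2) F ij.
    rewrite linear_sum -(pair_bigA _ (fun i j => F (i, j))).
    apply: eq_bigr => i _; rewrite linearZ bar_bdry_symbol /F /=.
    apply: etrans (scaler_sumr _ _ _ _) _.
    by apply: eq_bigr => j _; rewrite scalerA -exprD.
  set s := \sum_ij F ij.
  have sN : s = - s.
    rewrite {1}/s (reindex_inj (inv_inj (@swapK k))) -sumrN.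
    by apply: eq_bigr => ij _; rewrite /F face_swap sign_swap scaleNr.
  have : 2 *: s = 0 by rewrite scaler_nat mulr2n {1}sN addNr.
  by move/eqP; rewrite scaler_eq0 pnatr_eq0 => /eqP.
rewrite -[c]freeg_sumE !linear_sum big1 // => g _.
rewrite (_ : << _ *g g >> = coeff g c *: (<< g >> : bar_chain k.+2)).
  by rewrite 2!linearZ basis; apply: scaler0.
by apply/eqP/freeg_eqP => h; rewrite coeffZ !coeffU mul1r.
Qed.

Definition bar_complex : chain_complex R[i] := ChainComplex bar_bdryK.

Section Norm.
Context (S : {fset G}) (p : R).

(* [^+] and [`^] both satisfy 0 ^ 0 = 1, so n = 0 gives the plain l^p norm. *)
Definition lp_norm (n k : nat) (c : bar_chain k) : R :=
  (\sum_(g \in [set: k.-tuple G])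
     normc (coeff g c) `^ p * (diam S g)%:R ^+ n) `^ p^-1.

(* The boundary of a 0-chain is zero. *)
Definition graph_norm (n k : nat) : bar_chain k -> R :=
  match k with
  | 0 => fun c => lp_norm n c
  | j.+1 => fun c => lp_norm n c + lp_norm n (bar_bdry j c)
  end.

Context (hp : 1 <= p).
Let p0 : 0 < p. Proof. exact: lt_le_trans hp. Qed.

Lemma lp_normE n k (r : seq (k.-tuple G)) (c : bar_chain k) :
  uniq r -> {subset dom c <= r} ->
  lp_norm n c =
  (\sum_(g <- r) normc (coeff g c) `^ p * (diam S g)%:R ^+ n) `^ p^-1.
Proof.
move=> ur cr; rewrite /lp_norm (fsbigE r) //.
  by congr (_ `^ _); apply: eq_bigl => g; rewrite in_setT.
move=> g _ gr; rewrite coeff_outdom; last by apply: contra gr; apply: cr.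
by rewrite normc0 powR0 ?gt_eqF // mul0r.
Qed.

Lemma lp_norm_ge0 n k (c : bar_chain k) : 0 <= lp_norm n c.
Proof. exact: powR_ge0. Qed.

Lemma lp_normD n k (c d : bar_chain k) :
  lp_norm n (c + d) <= lp_norm n c + lp_norm n d.
Proof.
pose r := undup (dom c ++ dom d).
have ur : uniq r by exact: undup_uniq.
rewrite !(@lp_normE _ _ r) //; last 3 first.
- by move=> g gd; rewrite mem_undup mem_cat gd orbT.
- by move=> g gc; rewrite mem_undup mem_cat gc.
- by move=> g /domD_subset; rewrite mem_undup.
have w0 (g : k.-tuple G) : 0 <= (diam S g)%:R ^+ n :> R by rewrite exprn_ge0.
have nc0 (z : R[i]) : 0 <= normc z by case: z => a b; apply: sqrtr_ge0.
have sum0 (u : k.-tuple G -> R) :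
    0 <= \sum_(g <- r) u g `^ p * (diam S g)%:R ^+ n.
  by apply: sumr_ge0 => g _; rewrite mulr_ge0 ?powR_ge0.
apply: le_trans (finite_minkowski hp r (fun g => nc0 (coeff g c))
  (fun g => nc0 (coeff g d)) w0).
apply: ge0_ler_powR; rewrite ?nnegrE ?invr_ge0 ?sum0 ?(ltW p0) //.
apply: ler_sum => g _; apply: ler_wpM2r => //.
apply: ge0_ler_powR; rewrite ?nnegrE ?addr_ge0 ?nc0 ?(ltW p0) //.
by rewrite coeffD; apply: le_normcD.
Qed.

Lemma lp_normZ n k a (c : bar_chain k) :
  lp_norm n (a *: c) = normc a * lp_norm n c.
Proof.
have nc0 (z : R[i]) : 0 <= normc z by case: z => x y; apply: sqrtr_ge0.
rewrite !(@lp_normE _ _ (dom c)) ?uniq_dom //; last exact: domZ_subset.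
under eq_bigr do rewrite coeffZ normcM powRM // -mulrA.
rewrite -mulr_sumr powRM ?powR_ge0 //; last first.
  by apply: sumr_ge0 => g _; rewrite mulr_ge0 ?powR_ge0 ?exprn_ge0.
by rewrite -powRrM mulfV ?gt_eqF // powRr1.
Qed.

Lemma graph_norm_ge0 n k (c : bar_chain k) : 0 <= graph_norm n c.
Proof. by case: k c => [|k] c; rewrite ?addr_ge0 ?lp_norm_ge0. Qed.

Lemma graph_normD n k (c d : bar_chain k) :
  graph_norm n (c + d) <= graph_norm n c + graph_norm n d.
Proof.
case: k c d => [|k] c d; first exact: lp_normD.
by rewrite /graph_norm linearD addrACA lerD ?lp_normD.
Qed.

Lemma graph_normZ n k a (c : bar_chain k) :
  graph_norm n (a *: c) = normc a * graph_norm n c.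
Proof.
case: k c => [|k] c; first exact: lp_normZ.
by rewrite /graph_norm linearZ mulrDr !lp_normZ.
Qed.

Definition lp_seminorms k : seminorms (bar_chain k) :=
  Seminorms (fun n => @graph_norm_ge0 n k) (fun n => @graph_normD n k)
    (fun n => @graph_normZ n k).

Lemma bar_bdry_continuous k :
  continuous_for (lp_seminorms k.+1) (lp_seminorms k) (bar_bdry k).
Proof.
move=> n; exists n, 1 => c; rewrite mul1r; case: k c => [|k] c /=.
  by rewrite lerDr lp_norm_ge0.
have -> : lp_norm n (bar_bdry k (bar_bdry k.+1 c)) = 0.
  by rewrite bar_bdryK -(scale0r (0 : bar_chain k)) lp_normZ normc0 mul0r.
by rewrite addr0 lerDr lp_norm_ge0.
Qed.

Definition lp_chain k : lmodType R[i] := completion (lp_seminorms k).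

Definition lp_bdry k : {linear lp_chain k.+1 -> lp_chain k} :=
  extension (@bar_bdry_continuous k).

Lemma lp_bdryK k (X : lp_chain k.+2) : lp_bdry k (lp_bdry k.+1 X) = 0.
Proof. exact: extension_comp0 (@bar_bdryK k). Qed.

Definition lp_complex : chain_complex R[i] := ChainComplex lp_bdryK.

Lemma embed_bdry k (c : bar_chain k.+1) :
  embed (lp_seminorms k) (bar_bdry k c) = lp_bdry k (embed (lp_seminorms k.+1) c).
Proof. by rewrite /lp_bdry extension_embed. Qed.

(* The canonical chain map into the completion: constant sequences. *)
Definition to_lp : chain_map bar_complex lp_complex :=
  @ChainMap _ bar_complex lp_complex (fun k => embed (lp_seminorms k)) embed_bdry.

End Norm.
End Bar.

(* Main.v *)
Require Import Defs.
From mathcomp Require Import all_boot all_order all_algebra.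
From mathcomp Require Import finmap all_classical all_reals.
From mathcomp Require Import complex.
From mathcomp Require Import all_analysis ring zify.
From mathcomp.multinomials Require Import freeg.
Import Order.TTheory GRing.Theory Num.Theory.
Import numFieldNormedType.Exports ComplexField.Normc.
Local Open Scope ring_scope.

Set Implicit Arguments.
Unset Strict Implicit.

(** The bar complex has a single generator in degree 0, so the boundary vanishes
    on degree 1 and every 1-chain is a cycle.  It suffices to treat the chain
    [e, g] for one element g.  For every h in the group,

      [e, g] = d [e, g, gh] + [e, gh] - [e, h],

    and averaging this over a finite set A gives [e, g] = d u + r, where u is
    the mean of the chains [e, g, gh] and r a difference of two means, of the
    [e, gh] and of the [e, h].  Each mean is spread over #A distinct simplices
    with equal weights 1 / #A, so its p-norm with weight diam^n is at most
    (#A^(1-p) * D^n)^(1/p), D being a bound for the diameters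
    ([lp_norm_mean]).  For p > 1 the first factor decays.  In a free group of
    rank 2 one can take for A the 2^N positive words of length N: #A is
    exponential in N while D grows linearly, so all these norms tend to 0
    ([lp_rate_cvg0]).

    Thus the 2-chains u_N tend to 0 while their boundaries tend to [e, g].  The
    norms that define the completion contain the p-norm of the boundary, hence
    (u_N) is Cauchy but not null: it defines an element of the completed
    2-chains, whose boundary is [e, g] ([embed_boundary]).  That such an element
    exists reflects that the boundary operator is not closable for the p-norms.

    The argument applies to every group that contains such sets A
    ([exponential_growth]). *)

(** * Word length and diameter *)

Section WordLength.
Context (G : groupType) (S : {fset G}).
Local Open Scope group_scope.

Lemma spellsM m n (g h : G) :
  spells S m g -> spells S n h -> spells S (m + n)%N (g * h).
Proof.
move=> [u [<- uS ->]] [v [<- vS ->]]; exists (u ++ v).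
rewrite size_cat big_cat; split=> // s.
by rewrite mem_cat => /orP[/uS|/vS].
Qed.

Lemma spellsV n (g : G) : spells S n g -> spells S n g^-1.
Proof.
move=> [w [<- wS ->]]; exists (rev [seq s^-1 | s <- w]).
rewrite size_rev size_map; split=> // [s|].
  by rewrite mem_rev => /mapP[t /wS + ->]; rewrite invgK orbC.
elim: w {wS} => [|s w IH]; first by rewrite !big_nil invg1.
by rewrite big_cons invgM IH map_cons rev_cons -cats1 big_cat big_seq1.
Qed.

Lemma word_length_le n (g : G) : spells S n g -> (word_length S g <= n)%N.
Proof.
move=> gn; rewrite /word_length; case: pselect => // e.
by case: ex_minnP => m _; apply; apply/asboolP.
Qed.

Hypothesis genS : generates S.

Lemma spells_word_length (g : G) : spells S (word_length S g) g.
Proof.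
rewrite /word_length; case: pselect => [e|[]].
  by case: ex_minnP => m /asboolP.
by have [n gn] := genS g; exists n; apply/asboolP.
Qed.

Lemma word_lengthM (g h : G) :
  (word_length S (g * h) <= word_length S g + word_length S h)%N.
Proof. by apply/word_length_le/spellsM; apply: spells_word_length. Qed.

Lemma word_lengthV (g : G) : (word_length S g^-1 <= word_length S g)%N.
Proof. exact/word_length_le/spellsV/spells_word_length. Qed.

Lemma word_length1 : word_length S 1 = 0%N.
Proof.
apply/eqP; rewrite -leqn0; apply: word_length_le.
by exists [::]; split=> //; rewrite big_nil.
Qed.

(** The constant 2 comes from comparing two points of the simplex through e. *)
Lemma diam_le k (g : k.-tuple G) L :
  (forall x, x \in g -> (word_length S x <= L)%N) -> (diam S g <= 2 * L)%N.
Proof.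
move=> gL; have eL x : x \in (1 :: g : seq G) -> (word_length S x <= L)%N.
  by rewrite in_cons => /orP[/eqP->|/gL//]; rewrite word_length1.
apply/bigmax_leqP_seq => x /eL xL _; apply/bigmax_leqP_seq => y /eL yL _.
apply: leq_trans (word_lengthM _ _) _; rewrite mul2n -addnn leq_add //.
exact: leq_trans (word_lengthV _) xL.
Qed.

End WordLength.

(** * The bar complex in degrees 1 and 2 *)

Section Bar1.
Context (R : realType) (G : groupType).

Lemma cycle_bar1 (g : 1.-tuple G) :
  (<< g >> : bar_chain R G 1) \in @Defs.cycle _ (bar_complex R G) 1.
Proof.
rewrite unfold_in /= -[<< g >>]symbol1; apply/eqP; rewrite [LHS]bar_bdry_symbol.
rewrite big_ord_recr big_ord1 /= expr0 expr1 scale1r scaleN1r.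
rewrite (_ : symbol R (face _ _) = symbol R (face ord_max [tuple of 1%g :: g])) ?subrr //.
by congr << _ >>; rewrite [LHS]tuple0 [RHS]tuple0.
Qed.

(** This is the relation that trades [e, g] for the more remote simplices
    [e, gh] and [e, h]. *)
Lemma bar_bdry2 (g h : G) :
  bar_bdry R G 1 << [tuple g; g * h]%g >> =
  << [tuple h] >> - << [tuple g * h]%g >> + << [tuple g] >>.
Proof.
rewrite -symbol1 bar_bdry_symbol !big_ord_recr big_ord0 /= add0r.
rewrite expr0 expr1 sqrrN expr1n !scale1r scaleN1r.
set x := [tuple of _].
have faceE (j : 'I_3) (y : 2.-tuple G) :
    (forall i : 'I_2, nth 1%g y i = nth 1%g x (bump j i)) -> face j x = y.
  move=> yE; apply: eq_from_tnth => i.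
  by rewrite tnth_mktuple !(tnth_nth 1%g) yE.
rewrite (faceE _ [tuple g; g * h]%g); last by case=> [[|[|]]].
rewrite (faceE _ [tuple of 1 :: [tuple g * h]]%g); last by case=> [[|[|]]].
rewrite (faceE _ [tuple of 1 :: [tuple g]]%g); last by case=> [[|[|]]].
rewrite !symbol1; congr (_ - _ + _); congr << _ >>.
by apply: val_inj; rewrite /= /thead (tnth_nth 1%g) /= mulKg.
Qed.

End Bar1.

(** * Means of distinct simplices have small norm *)

Section Mean.
Context (R : realType) (G : groupType) (S : {fset G}) (p : R) (hp : 1 < p).

Lemma lp_normB n k (c d : bar_chain R G k) :
  lp_norm S p n (c - d) <= lp_norm S p n c + lp_norm S p n d.
Proof.
apply: le_trans (lp_normD _ (ltW hp) _ _ _) _.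
by rewrite -scaleN1r lp_normZ ?(ltW hp) // normcN normc1 mul1r.
Qed.

Definition mean k (r : seq (k.-tuple G)) : bar_chain R G k :=
  (size r)%:R^-1 *: \sum_(x <- r) << x >>.

(** The sum of the p-th powers has (size r) terms, each at most
    (size r)^(-p) * D^n. *)
Lemma lp_norm_mean n k (r : seq (k.-tuple G)) D :
  uniq r -> (0 < size r)%N -> {in r, forall x, (diam S x <= D)%N} ->
  lp_norm S p n (mean r) <= ((size r)%:R `^ (1 - p) * D%:R ^+ n) `^ p^-1.
Proof.
move=> ur r0 rD; have p0 : 0 < p by rewrite (lt_trans ltr01).
have coeffE x : coeff x (mean r) = (size r)%:R^-1 * (x \in r)%:R.
  rewrite coeffZ raddf_sum /=; congr (_ * _).
  under eq_bigr do rewrite coeffU mul1r.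
  rewrite -natr_sum -(count_uniq_mem x ur) -sum1_count [in RHS]big_mkcond.
  by congr (_%:R); apply: eq_bigr => y _; rewrite /=; case: eqP.
have rsub : {subset dom (mean r) <= r}.
  move=> x; rewrite mem_dom coeffE; apply: contraR => /negPf ->.
  by rewrite mulr0.
rewrite (lp_normE _ (ltW hp) _ ur rsub).
apply: ge0_ler_powR; rewrite ?invr_ge0 ?(ltW p0) ?nnegrE //.
  by apply: sumr_ge0 => x _; rewrite mulr_ge0 ?powR_ge0 ?exprn_ge0.
have -> : (size r)%:R `^ (1 - p) * D%:R ^+ n =
    \sum_(x <- r) (size r)%:R `^ (- p) * D%:R ^+ n :> R.
  rewrite big_const_seq count_predT iter_addr_0 -[RHS]mulr_natl mulrA.
  by congr (_ * _); rewrite powRD ?powRr1 ?ler0n// (eqr_nat _ _ 0) -lt0n r0 implybT.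
rewrite big_seq [leRHS]big_seq; apply: ler_sum => x xr.
rewrite coeffE xr mulr1 normcV normcMn normc1 -powR_inv1 ?ler0n // -powRrM mulN1r.
by rewrite ler_wpM2l ?powR_ge0 // lerXn2r ?nnegrE ?ler0n // ler_nat rD.
Qed.

End Mean.

Section Limit.
Local Open Scope classical_set_scope.
Context (R : realType) (p : R) (hp : 1 < p).

(** With t = (p - 1) ln 2 / 2, the exponential factor is exp (- 2 t N).  One half
    of it absorbs the polynomial factor, because x^n <= n! exp x; the other half
    leaves a geometric sequence as upper bound. *)
Lemma lp_rate_cvg0 (C n : nat) :
  ((2 ^ N)%N%:R `^ (1 - p) * (C * N.+1)%N%:R ^+ n) `^ p^-1 @[N --> \oo] --> (0 : R).
Proof.
have p0 : 0 < p by rewrite (lt_trans ltr01).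
pose t : R := (p - 1) * ln 2 / 2.
have t0 : 0 < t by rewrite divr_gt0 ?mulr_gt0 ?subr_gt0 ?ln_gt0 ?ltr1n.
have pow_le (x : R) : 0 <= x -> x ^+ n <= n`!%:R * expR x.
  move=> x0; case: n => [|m]; first by rewrite expr0 mul1r -expR0 ler_expR.
  rewrite mulrC -ler_pdivrMr ?ltr0n ?fact_gt0 //.
  by apply: le_trans (expR_ge1Dxn m x0); rewrite lerDr.
pose K : R := C%:R ^+ n * (n`!%:R / t ^+ n * expR t).
have K0 : 0 <= K by rewrite !mulr_ge0 ?invr_ge0 ?exprn_ge0 ?expR_ge0 ?(ltW t0).
apply: (@squeeze_cvgr _ _ _ _ (cst 0) (geometric (K `^ p^-1) (expR (- t / p)))).
- apply: nearW => N; rewrite powR_ge0 /= -expRM_natr.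
  have -> : expR (- t / p * N%:R) = expR (- t * N%:R) `^ p^-1.
    by rewrite -expRM mulrAC.
  rewrite -powRM ?expR_ge0 //; apply: ge0_ler_powR;
    rewrite ?nnegrE ?invr_ge0 ?(mulr_ge0 K0) ?mulr_ge0 ?powR_ge0 ?exprn_ge0 ?expR_ge0 ?(ltW p0) //.
  have -> : (2 ^ N)%N%:R `^ (1 - p) = expR (- t * N%:R) * expR (- t * N%:R) :> R.
    rewrite /powR pnatr_eq0 expn_eq0 /= -expRD natrX lnXn ?ltr0n // -[ln _ *+ N]mulr_natr.
    by congr expR; rewrite /t; field.
  rewrite mulrC mulrA ler_wpM2r ?expR_ge0 //.
  have tN0 : 0 <= t * N.+1%:R by rewrite mulr_ge0 // ltW.
  have /(ler_wpM2l (_ : 0 <= C%:R ^+ n / t ^+ n)) := pow_le _ tN0.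
  rewrite mulr_ge0 ?exprn_ge0 ?invr_ge0 ?exprn_ge0 ?(ltW t0) //.
  move=> /(_ isT) le; rewrite mulNr expRN ler_pdivrMr ?expR_gt0 //.
  rewrite natrM exprMn; apply: (le_trans _ (le_trans le _)).
    by rewrite [X in _ <= _ * X]exprMn mulrA divfK ?expf_neq0 ?gt_eqF.
  rewrite -[N.+1%:R]nat1r mulrDr mulr1 expRD /K le_eqVlt.
  apply/orP; left; apply/eqP.
  move: (expR t) (expR (t * _)) (C%:R ^+ n) (n`!%:R : R) (t ^- n) => a b c d e.
  ring.
- exact: cvg_cst.
- apply: cvg_geometric; rewrite ger0_norm ?expR_ge0 // expR_lt1.
  by rewrite mulNr oppr_lt0 divr_gt0.
Qed.

End Limit.

(** * Boundaries in the completion *)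

(** The limit of (u N) need not come from V, but f sends it to the limit of the
    f (u N). *)
Lemma extension_limit (R : realType) (V W : lmodType R[i]) (q : seminorms V)
    (r : seminorms W) (f : {linear V -> W}) (fb : continuous_for q r f)
    (u : nat -> V) (z : W) :
  u \in cauchy_seq q ->
  (forall n, (r n (f (u N) - z) @[N --> \oo] --> 0)%classic) ->
  exists X, extension fb X = embed r z.
Proof.
move=> uC fuz; refine (ex_intro _ (class _ (@SubMod _ _ _ u uC)) _).
apply/eqP; rewrite embedE /extension subquot_map_class class_eq; exact/asboolP.
Qed.

Section Boundary.
Local Open Scope classical_set_scope.
Context (R : realType) (G : groupType) (S : {fset G}) (p : R) (hp : 1 < p).

(** Since the graph norms on degree k + 1 control u and its boundary separately,
    u is Cauchy as soon as both converge, even if u tends to 0 and its boundary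
    does not. *)
Lemma embed_boundary k (z : bar_chain R G k) (u : nat -> bar_chain R G k.+1) :
  z \in @Defs.cycle _ (bar_complex R G) k ->
  (forall n, lp_norm S p n (u N) @[N --> \oo] --> 0) ->
  (forall n, lp_norm S p n (bar_bdry R G k (u N) - z) @[N --> \oo] --> 0) ->
  embed (lp_seminorms S (ltW hp) k) z
    \in @boundary _ (lp_complex S (ltW hp)) k.
Proof.
move=> zZ u0 bu0; pose q := lp_seminorms S (ltW hp).
have uC : u \in cauchy_seq (q k.+1).
  apply/asboolP => n.
  pose e N := lp_norm S p n (u N) + lp_norm S p n (bar_bdry R G k (u N) - z).
  have e0 : e N @[N --> \oo] --> 0.
    by rewrite -[0 in X in _ --> X]addr0; apply: cvgD.
  apply: (@squeeze_cvgr _ _ _ _ (cst 0) (fun ij : nat * nat => e ij.1 + e ij.2)).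
  - apply: nearW => -[i j]; apply/andP; split; first exact: sn_ge0.
    have -> : q k.+1 n (u i - u j) = lp_norm S p n (u i - u j) +
        lp_norm S p n (bar_bdry R G k (u i - u j)) by [].
    rewrite /e addrACA; apply: lerD; first exact: lp_normB.
    rewrite (linearB (bar_bdry R G k)).
    have -> : bar_bdry R G k (u i) - bar_bdry R G k (u j) =
        (bar_bdry R G k (u i) - z) - (bar_bdry R G k (u j) - z).
      by rewrite opprB addrA subrK.
    exact: lp_normB.
  - exact: cvg_cst.
  - rewrite -[0 in X in _ --> X]addr0.
    apply: cvgD; [exact: (cvg_comp _ _ cvg_fst e0)|exact: (cvg_comp _ _ cvg_snd e0)].
(* The graph norm of z' = d (u N) - z is its p-norm, because d z' = 0. *)
have buz n : (q k n (bar_bdry R G k (u N) - z) @[N --> \oo] --> 0)%classic.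
  case: k @q z u zZ bu0 {u0 uC} => [|k] q z u zZ bu0; first exact: bu0.
  rewrite (_ : (fun _ => _) = fun N => lp_norm S p n (bar_bdry R G k.+1 (u N) - z)).
    exact: bu0.
  apply/funext => N.
  have -> : q k.+1 n (bar_bdry R G k.+1 (u N) - z) =
      lp_norm S p n (bar_bdry R G k.+1 (u N) - z) +
      lp_norm S p n (bar_bdry R G k (bar_bdry R G k.+1 (u N) - z)) by [].
  have /eqP z0 : bar_bdry R G k z == 0 by exact: zZ.
  rewrite (linearB (bar_bdry R G k)) bar_bdryK z0 subr0.
  by rewrite -(scale0r (0 : bar_chain R G k)) lp_normZ ?(ltW hp) // normc0 mul0r addr0.
have [X Xz] := extension_limit (bar_bdry_continuous S (ltW hp) k) uC buz.
apply/asboolP; exists X; exact: esym Xz.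
Qed.

End Boundary.

(** * Groups of exponential growth *)

Section Growth.
Local Open Scope classical_set_scope.
Context (G : groupType) (S : {fset G}).

(** Base 2 is a normalization: a set that is larger than 2^N can be cut down, and
    any other growth rate above 1 gives this one after rescaling N. *)
Definition exponential_growth :=
  exists C, forall N, exists A : seq G, [/\ uniq A, size A = (2 ^ N)%N &
    {in A, forall h, (word_length S h <= C * N.+1)%N}].

Context (R : realType) (p : R) (hp : 1 < p).
Context (genS : generates S) (growthS : exponential_growth).

Lemma symbol_is_lp_boundary (g : G) :
  embed (lp_seminorms S (ltW hp) 1) (<< [tuple g] >> : bar_chain R G 1)
    \in @boundary _ (lp_complex S (ltW hp)) 1.
Proof.
have [C growthC] := growthS.
have [A AP] := choice growthC.
(* Vertices g, h, gh have length at most |g| + C * (N + 1), and the diameter is at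
   most twice that. *)
pose D := (2 * (word_length S g + C))%N.
pose rate n N : R := ((2 ^ N)%N%:R `^ (1 - p) * (D * N.+1)%N%:R ^+ n) `^ p^-1.
have norm_mean k (t : G -> k.-tuple G) n N : injective t ->
    (forall h x, x \in t h ->
      (word_length S x <= word_length S g + word_length S h)%N) ->
    lp_norm S p n (mean R [seq t h | h <- A N]) <= rate n N.
  have [uA sA lA] := AP N => t_inj tL.
  rewrite /rate -sA -(size_map t); apply: lp_norm_mean => //.
  - by rewrite map_inj_uniq.
  - by rewrite size_map sA expn_gt0.
  move=> _ /mapP[h hA ->].
  apply: (@leq_trans (2 * (word_length S g + word_length S h))).
    by apply: diam_le => // x /tL.
  by have := lA _ hA; rewrite /D; lia.
pose u N := mean R [seq [tuple g; g * h]%g | h <- A N].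
have bu N : bar_bdry R G 1 (u N) - << [tuple g] >> =
    mean R [seq [tuple h] | h <- A N] - mean R [seq [tuple g * h]%g | h <- A N].
  have [_ sA _] := AP N.
  rewrite /u /mean [bar_bdry R G 1 _]linearZ [in LHS]linear_sum.
  rewrite !size_map !big_map; under eq_bigr do rewrite bar_bdry2.
  rewrite !big_split /= sumrN big_const_seq count_predT iter_addr_0 scalerDr scalerBr.
  rewrite -(scaler_nat _ (<< [tuple g] >> : bar_chain R G 1)) scalerA mulVf ?scale1r ?addrK //.
  by rewrite sA pnatr_eq0 expn_eq0.
apply: (@embed_boundary _ _ _ _ hp _ _ u); first exact: cycle_bar1.
  move=> n; apply: (@squeeze_cvgr _ _ _ _ (cst 0) (rate n)).
  - apply: nearW => N; rewrite lp_norm_ge0 /=; apply: norm_mean.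
      by move=> h h' /(congr1 val) [] /mulgI.
    move=> h x; rewrite !inE => /orP[] /eqP ->; first exact: leq_addr.
    exact: word_lengthM.
  - exact: cvg_cst.
  - exact: lp_rate_cvg0.
move=> n.
apply: (@squeeze_cvgr _ _ _ _ (cst 0) (fun N => rate n N + rate n N)).
- apply: nearW => N; rewrite lp_norm_ge0 /= bu.
  apply: le_trans (lp_normB _ hp _ _ _) _; apply: lerD; apply: norm_mean.
  + by move=> h h' /(congr1 val) [].
  + by move=> h x; rewrite !inE => /eqP ->; apply: leq_addl.
  + by move=> h h' /(congr1 val) [] /mulgI.
  + by move=> h x; rewrite !inE => /eqP ->; apply: word_lengthM.
- exact: cvg_cst.
- by rewrite -[0 in X in _ --> X]addr0; apply: cvgD; apply: lp_rate_cvg0.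
Qed.

Lemma chain_is_lp_boundary (c : bar_chain R G 1) :
  embed (lp_seminorms S (ltW hp) 1) c \in @boundary _ (lp_complex S (ltW hp)) 1.
Proof.
have -> : c = \sum_(g <- dom c) coeff g c *: (<< g >> : bar_chain R G 1).
  rewrite -[LHS]freeg_sumE; apply: eq_bigr => g _.
  by apply/eqP/freeg_eqP => h; rewrite coeffZ !coeffU mul1r.
rewrite linear_sum; apply: rpred_sum => g _; rewrite linearZ; apply: rpredZ.
rewrite (_ : g = [tuple thead g]); first exact: symbol_is_lp_boundary.
by apply: val_inj; case: g => -[|x []].
Qed.

Lemma homology_map_to_lp_eq0 (x : homology (bar_complex R G) 1) :
  homology_map (to_lp S (ltW hp)) 1 x = 0.
Proof.
have [c ->] := classP x; rewrite /homology_map subquot_map_class; apply/eqP.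
rewrite class_eq0; exact: chain_is_lp_boundary.
Qed.

End Growth.

(** * Positive words in free groups *)

Section PositiveWords.
Context (T : choiceType).

Definition positive_letters (w : seq T) : seq (letter T) :=
  [seq (x, true) | x <- w].

Lemma positive_is_reduced w : is_reduced (positive_letters w).
Proof.
case: w => // x w; rewrite /is_reduced; elim: w x => //= y w IH x.
by rewrite xpair_eqE andbF IH.
Qed.

Definition positive_word w : free_group T := FreeGroup (positive_is_reduced w).

Lemma positive_word_inj : injective positive_word.
Proof. by move=> v w [] /inj_map; apply=> x y []. Qed.

Lemma positive_word_cons x w :
  positive_word (x :: w) = (free_gen x * positive_word w)%g.
Proof.
by apply: val_inj; case: w => //= y w; rewrite xpair_eqE andbF.
Qed.

Lemma word_length_positive (S : {fset free_group T}) C w : generates S ->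
  (forall x, word_length S (free_gen x) <= C)%N ->
  (word_length S (positive_word w) <= C * size w)%N.
Proof.
move=> genS genC; elim: w => [|x w IH].
  have -> : positive_word [::] = 1%g by apply: val_inj.
  by rewrite word_length1.
rewrite positive_word_cons mulnS.
apply: leq_trans (word_lengthM genS _ _) _; exact: leq_add.
Qed.

End PositiveWords.

(** The positive words of length N are pairwise distinct, as no cancellation
    occurs among them. *)
Lemma F2_growth (S : {fset F2}) : generates S -> exponential_growth S.
Proof.
move=> genS.
exists (\max_(x : 'I_2) word_length S (free_gen x)) => N.
exists [seq positive_word (tval w) | w <- enum {: N.-tuple 'I_2}]; split.
- rewrite map_inj_uniq ?enum_uniq // => v w /positive_word_inj; exact: val_inj.
- by rewrite size_map -cardE card_tuple card_ord.
move=> _ /mapP[w _ ->].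
apply: leq_trans (word_length_positive _ genS _) _.
  by move=> x; exact: (leq_bigmax x).
by rewrite size_tuple leq_mul2l leqnSn orbT.
Qed.

Theorem theorem4p1 (R : realType) (p : R) (hp : 1 < p)
    (S : {fset F2}) (hS : generates S)
    (x : homology (bar_complex R F2) 1) :
  homology_map (to_lp S (ltW hp)) 1 x = 0.
Proof. exact: (homology_map_to_lp_eq0 hp hS (F2_growth hS)). Qed.
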